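(* There is a constant $c>0$ such that every cycle $G$ with $n$ vertices satisfies $\widetilde{\mathsf{VC}}(G)\ge c\,n^2$.
   Context: Unweighted deterministic walk: each vertex $u$ has a rotor sequence of length $\tilde d(u)$ of neighbours of $u$, each occurring exactly $\tilde d(u)/\deg(u)$ times, and an initial rotor position; the walk moves from the current vertex to the vertex its rotor points at and then advances that rotor cyclically. $\widetilde{\mathsf{VC}}(G)$ is the maximum over start vertices and all rotor sequences/initial positions (lengths fixed) of the least $t$ by which all vertices have been visited. *)

(* Defs.v *)
From mathcomp Require Import all_boot.

Set Implicit Arguments.
Unset Strict Implicit.
Unset Printing Implicit Defensive.

Record graph := Graph {
  vertex :> finType;
  edge : rel vertex;
  edge_sym : symmetric edge;
  edge_irrefl : irreflexive edge;
  edge_connected : forall x y : vertex, connect edge x y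
}.

Definition deg (G : graph) (u : G) : nat := #|[set v | edge u v]|.

(* The vertices can be listed without repetition in a cyclic order such that
   adjacency is being cyclically consecutive. *)
Definition is_cycle (G : graph) : Prop :=
  exists s : seq G, [/\ 2 < size s, uniq s, s =i G &
    forall x y : G, edge x y = (y == next s x) || (x == next s y)].

Section RotorWalk.
Variables (G : graph) (d : G -> nat).

(* A neighbour occurs d u / deg u times; stated multiplicatively, so no
   rounding can occur. *)
Definition rotor_seqs_ok (s : {dffun forall u : G, (d u).-tuple G}) : bool :=
  [forall u, all (edge u) (s u) &&
    [forall v, edge u v ==> (count_mem v (s u) * deg u == d u)]].

Definition rotor_seqs : Type :=
  {s : {dffun forall u : G, (d u).-tuple G} | rotor_seqs_ok s}.

Definition rotor_pos : Type := {dffun forall u : G, 'I_(d u)}.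

Definition rotor_state : Type := (G * rotor_pos)%type.

Definition rotor_step (s : rotor_seqs) (z : rotor_state) : rotor_state :=
  let: (x, r) := z in
  (tnth (val s x) (r x),
   [ffun u => if u == x then ordS (r u) else r u] : rotor_pos).

Definition walk (s : rotor_seqs) (x : G) (r : rotor_pos) (t : nat) : G :=
  (iter t (rotor_step s) (x, r)).1.

Definition covered (s : rotor_seqs) (x : G) (r : rotor_pos) (t : nat) : bool :=
  [forall v : G, exists i : 'I_t.+1, walk s x r i == v].

Lemma iter_ordS n (i j : 'I_n) : exists m, iter m (@ordS n) i = j.
Proof.
have E m : val (iter m (@ordS n) i) = (i + m) %% n.
  elim: m => [|m IH]; first by rewrite addn0 modn_small.
  by rewrite iterS [LHS]/= IH -addn1 modnDml addn1 addnS.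
exists (n - i + j); apply: val_inj; rewrite E addnA subnKC; last exact: ltnW.
by rewrite modnDl modn_small.
Qed.

Lemma rotor_return s (z : rotor_state) p :
    0 < p -> iter p (rotor_step s) z = z ->
  exists k, (iter k (rotor_step s) z).1 = z.1 /\
            (iter k (rotor_step s) z).2 z.1 = ordS (z.2 z.1).
Proof.
move=> p0 pz; set f := rotor_step s in pz *.
have ex : exists k, (0 < k) && ((iter k f z).1 == z.1).
  by exists p; rewrite p0 pz eqxx.
case: (ex_minnP ex) => k /andP[k0 /eqP kz] kmin; exists k; split=> //.
suff H i : 0 < i <= k -> (iter i f z).2 z.1 = ordS (z.2 z.1).
  by apply: H; rewrite k0 leqnn.
elim: i => [//|i IH] /= ik.
case: i IH ik => [|i] IH ik.
  by rewrite /= /f /rotor_step; case: (z) => x r /=; rewrite ffunE eqxx.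
have {IH} <- : (iter i.+1 f z).2 z.1 = ordS (z.2 z.1).
  by apply: IH; rewrite /= ltnW.
have ne : (iter i.+1 f z).1 != z.1.
  apply: contraTneq ik => E; rewrite -leqNgt.
  by apply: kmin; rewrite E eqxx.
rewrite /f {1}/rotor_step -/f; case: (iter i.+1 f z) ne => x r /= ne.
by rewrite ffunE eq_sym (negbTE ne).
Qed.

Lemma rotor_edge s (z : rotor_state) p v :
    0 < p -> iter p (rotor_step s) z = z -> edge z.1 v ->
  exists k, (iter k (rotor_step s) z).1 = v.
Proof.
move=> p0 pz uv; set f := rotor_step s in pz *.
have per k : iter p f (iter k f z) = iter k f z.
  by rewrite -iterD addnC iterD pz.
have ret m : exists k, (iter k f z).1 = z.1 /\
    (iter k f z).2 z.1 = iter m (@ordS _) (z.2 z.1).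
  elim: m => [|m [k [k1 k2]]]; first by exists 0.
  have [l [l1 l2]] := rotor_return p0 (per k).
  exists (l + k); rewrite iterD l1 -/f; split=> //.
  by move: l2; rewrite -/f k1 => ->; rewrite k2.
have vs : v \in val s z.1.
  have /forallP/(_ z.1)/andP[_ /forallP/(_ v)] := valP s.
  rewrite uv => /eqP E; rewrite -has_pred1 has_count lt0n.
  apply: contraTneq (leq_ltn_trans (leq0n _) (ltn_ord (z.2 z.1))) => E0.
  by move: E; rewrite E0 mul0n => <-.
have /tnthP[j vj] := vs.
have [m mj] := iter_ordS (z.2 z.1) j.
have [k [k1 k2]] := ret m.
exists k.+1; rewrite iterS vj -mj -k2 {1}/f /rotor_step.
by case: (iter k f z) k1 => x r /= ->.
Qed.

Lemma cover_exists s x r : exists t, covered s x r t.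
Proof.
set f := rotor_step s; set a : rotor_state := (x, r).
have /trajectP[i im E] := looping_order f a.
set z := iter i f a; set p := order f a - i.
have p0 : 0 < p by rewrite subn_gt0.
have pz : iter p f z = z by rewrite -iterD subnK // ltnW.
have per k : iter p f (iter k f z) = iter k f z.
  by rewrite -iterD addnC iterD pz.
have reach v : exists k, (iter k f a).1 == v.
  suff [k <-] : exists k, (iter k f z).1 = v.
    by exists (k + i); rewrite iterD.
  have /connectP[q] := edge_connected z.1 v.
  elim/last_ind: q v => [|q w IH] v; first by move=> _ ->; exists 0.
  rewrite rcons_path last_rcons => /andP[qz qw] ->.
  have [k kE] := IH _ qz erefl.
  rewrite -kE in qw.
  have [l lE] := rotor_edge p0 (per k) qw.
  by exists (l + k); rewrite iterD.
exists (\max_v ex_minn (reach v)); apply/forallP => v.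
have lev : ex_minn (reach v) < (\max_v ex_minn (reach v)).+1.
  by rewrite ltnS (leq_bigmax v).
apply/existsP; exists (Ordinal lev).
by rewrite /walk /=; case: ex_minnP.
Qed.

Definition cover_time (s : rotor_seqs) (x : G) (r : rotor_pos) : nat :=
  ex_minn (cover_exists s x r).

Definition VC : nat :=
  \max_(x : G) \max_(s : rotor_seqs) \max_(r : rotor_pos) cover_time s x r.

End RotorWalk.

(* Main.v *)
Require Import Defs.
From mathcomp Require Import all_boot all_order all_algebra reals.
From mathcomp Require Import zify.

(** Let every rotor alternate between the neighbour towards the start vertex
    and the one away from it, beginning with the former.  If rho is the distance
    to the start, then rho(position)^2 plus the sum of 2 rho(u) over the
    vertices u whose rotor currently points outwards starts at 0 and grows by
    at most 1 per step: an outward step gains at most 2 rho(u) + 1 in the square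
    and loses 2 rho(u) in the sum, an inward step the reverse.  Hence reaching
    distance rho takes at least rho^2 steps, and the antipode has distance
    floor(n/2). *)

Definition alternating {T : Type} (a b : T) (n : nat) : n.-tuple T :=
  [tuple if odd i then b else a | i < n].

Lemma count_alternating {T : eqType} (a b v : T) (n : nat) :
  ~~ odd n ->
  (count_mem v (alternating a b n)).*2 = n * ((a == v) + (b == v)).
Proof.
move=> n_even.
have -> : alternating a b n =
    [seq if odd i then b else a | i <- iota 0 n] :> seq T.
  by rewrite /= -val_enum_ord -map_comp.
rewrite -[in LHS](even_halfK n_even) -[in RHS](even_halfK n_even).
(* Any even starting index [m] is allowed, so that the induction can peel off one pair [a], [b] at a
   time. *)
suff H k m : ~~ odd m ->
    count_mem v [seq if odd i then b else a | i <- iota m k.*2]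
    = k * ((a == v) + (b == v)) by rewrite H //; lia.
elim: k m => [|k IH] m m_even; first by rewrite mul0n.
rewrite doubleS /= (negbTE m_even) /= IH ?negbK //; lia.
Qed.

(** The wrap-around goes from [n - 1], odd since [n] is even, to [0]. Hence advancing an alternating
    rotor always flips its direction. *)
Lemma odd_ordS n (i : 'I_n) : ~~ odd n -> odd (ordS i) = ~~ odd i.
Proof.
move=> n_even /=; have [En|i_max] := eqVneq i.+1 n.
  by move: n_even; rewrite -[X in odd X]En /= negbK => ->; rewrite En modnn.
by rewrite modn_small // ltn_neqAle i_max ltn_ord.
Qed.

Section AlternatingWalk.
Variables (G : graph) (d : G -> nat).
Variables (inw out : G -> G) (rho : G -> nat) (x0 : G).
Hypothesis d_even : forall u, ~~ odd (d u).
Hypothesis inw_neq_out : forall u, inw u != out u.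
Hypothesis edge_inw_out : forall u v, edge u v = (v == inw u) || (v == out u).
Hypothesis rho0 : rho x0 = 0.
Hypothesis rho_inw : forall u, u != x0 -> rho (inw u) < rho u.
(** No neighbour of [x0] is closer to [x0], so [inw x0] is merely one of the two and may lie at
    distance 1. *)
Hypothesis rho_inw0 : rho (inw x0) <= 1.
Hypothesis rho_out : forall u, rho (out u) <= (rho u).+1.

Lemma deg_inw_out (u : G) : deg u = 2.
Proof.
rewrite /deg (_ : [set v | edge u v] = [set inw u; out u]).
  by rewrite cards2 inw_neq_out.
by apply/setP => v; rewrite !inE edge_inw_out.
Qed.

Lemma alternating_ok :
  rotor_seqs_ok [ffun u => alternating (inw u) (out u) (d u)].
Proof.
apply/forallP => u; rewrite ffunE; apply/andP; split.
  by apply/all_tnthP => i; rewrite tnth_mktuple edge_inw_out;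
    case: odd; rewrite eqxx ?orbT.
apply/forallP => v; apply/implyP; rewrite edge_inw_out deg_inw_out muln2.
rewrite count_alternating ?d_even // => /orP[] /eqP ->.
  by rewrite eqxx [out u == _]eq_sym (negbTE (inw_neq_out u)) muln1.
by rewrite eqxx (negbTE (inw_neq_out u)) muln1.
Qed.

Definition alternating_seqs : rotor_seqs d := Sub _ alternating_ok.

Definition potential (z : rotor_state d) : nat :=
  rho z.1 ^ 2 + \sum_u odd (z.2 u) * (rho u).*2.

Lemma potential_step z :
  potential (rotor_step alternating_seqs z) <= (potential z).+1.
Proof.
case: z => x r; rewrite /potential /= ffunE tnth_mktuple.
rewrite (bigD1 x) //= [in leqRHS](bigD1 x) //= ffunE eqxx odd_ordS //.
rewrite (eq_bigr (fun u => odd (r u) * (rho u).*2)); last first.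
  by move=> u ux; rewrite ffunE (negbTE ux).
rewrite !addnA -addSn leq_add2r.
case: odd; first by have := rho_out x; nia.
(* At [x0] the rotor has weight 0 in the sum, so only the square changes, from 0 to at most 1. *)
have [->|/rho_inw] := eqVneq x x0; last by nia.
by have := rho_inw0; rewrite rho0; nia.
Qed.

Hypothesis d_gt0 : forall u, 0 < d u.

Lemma sqr_rho_le_VC v : rho v ^ 2 <= VC d.
Proof.
(* Position 0 is even, so every rotor points inwards and the potential starts at 0. *)
pose r0 : rotor_pos d := [ffun u => Ordinal (d_gt0 u)].
have potential_walk t :
      potential (iter t (rotor_step alternating_seqs) (x0, r0)) <= t.
  elim: t => [|t IH]; last by rewrite iterS (leq_trans (potential_step _)).
  by rewrite /potential /= rho0 big1 // => u _; rewrite ffunE.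
apply: leq_trans (_ : cover_time alternating_seqs x0 r0 <= _); last first.
  by do 3![apply: bigmax_sup; first exact: isT].
rewrite /cover_time; case: ex_minnP => t /forallP/(_ v)/existsP[i /eqP <-] _.
apply: leq_trans (leq_trans (potential_walk i) (ltn_ord i : i <= t)).
exact: leq_addr.
Qed.

End AlternatingWalk.

Lemma index_next {T : eqType} (s : seq T) (v : T) :
  uniq s -> v \in s -> index (next s v) s = (index v s).+1 %% size s.
Proof.
case: s => [//|x s] s_uniq vs; rewrite next_nth vs.
have := vs; rewrite -index_mem /= ltnS leq_eqVlt => /predU1P[->|lt_vs].
  (* For the last entry, [nth] runs past the end and returns its default, the head [x]: this is the
     wrap-around. *)
  by rewrite modnn nth_default //= eqxx.
rewrite modn_small //.
by have := index_uniq x (lt_vs : (index v (x :: s)).+1 < size (x :: s)) s_uniq.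
Qed.

Lemma cycle_VC (G : graph) (d : G -> nat) :
    is_cycle G -> (forall u, 0 < d u) -> (forall u, deg u %| d u) ->
  #|G|./2 ^ 2 <= VC d.
Proof.
move=> [s [s_gt2 s_uniq sG Es]] d_gt0 deg_d.
have cardG : #|G| = size s by rewrite -(card_uniqP s_uniq); apply: eq_card.
have insG v : v \in s by rewrite sG.
have idx_lt v : index v s < size s by rewrite index_mem.
have idx_next v := index_next _ _ s_uniq (insG v).
have idx_prev v : (index (prev s v) s).+1 %% size s = index v s.
  by rewrite -idx_next next_prev.
have mod_cases i : i < size s ->
    i.+1 %% size s = if i.+1 == size s then 0 else i.+1.
  by move=> lt_i; case: eqP => [->|ne]; rewrite ?modnn // modn_small //; lia.
have {idx_next} idx_next v : index (next s v) s =
    if (index v s).+1 == size s then 0 else (index v s).+1.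
  by rewrite idx_next mod_cases.
have {idx_prev} idx_prev v : index v s =
    if (index (prev s v) s).+1 == size s then 0 else (index (prev s v) s).+1.
  by rewrite -[LHS]idx_prev mod_cases.
(* With the start at index 0, going back along [s] leads home from the first half of the cycle,
   going forward from the second. At an exact antipode either choice works. *)
pose near v := index v s <= size s - index v s.
pose inw v := if near v then prev s v else next s v.
pose out v := if near v then next s v else prev s v.
pose rho v := minn (index v s) (size s - index v s).
have x00 : G by case: (s) s_gt2 => [|x].
pose x0 := nth x00 s 0.
have idx0 : index x0 s = 0 by rewrite index_uniq ?(ltn_trans _ s_gt2).
(* Otherwise two forward steps would return to the same vertex, forcing [size s] to divide 2. *)
have prev_neq_next v : prev s v != next s v.
  apply: contraTneq (idx_lt v) => E.
  by have := idx_next v; have := idx_prev v; rewrite E; do 2!case: eqP; lia.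
have inw_neq_out v : inw v != out v.
  by rewrite /inw /out; case: ifP; rewrite // eq_sym.
have edge_inw_out u v : edge u v = (v == inw u) || (v == out u).
  rewrite Es (eq_sym u) (can2_eq (prev_next s_uniq) (next_prev s_uniq)).
  by rewrite /inw /out; case: (near u); rewrite // orbC.
have d_even u : ~~ odd (d u).
  by have := deg_d u; rewrite (deg_inw_out _ _ _ inw_neq_out edge_inw_out) dvdn2.
have -> : #|G|./2 = rho (nth x00 s (size s)./2).
  rewrite /rho index_uniq ?cardG //; first by move: (size s) => n; lia.
  by move: (size s) s_gt2 => n; lia.
apply: (@sqr_rho_le_VC G d inw out rho x0) => //.
- by rewrite /rho idx0 min0n.
- move=> u /eqP u_neq0; rewrite /rho /inw /near.
  have idx_neq0 : index u s <> 0.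
    by move=> E; apply: u_neq0; rewrite /x0 -E nth_index.
  have := idx_lt u; have := idx_lt (prev s u).
  have := idx_next u; have := idx_prev u.
  by do 2!case: eqP; case: ifP; lia.
- rewrite /rho /inw /near idx0 /=.
  have := idx_lt (prev s x0); have := idx_prev x0; rewrite idx0.
  by case: eqP; lia.
- move=> u; rewrite /rho /out /near.
  have := idx_lt u; have := idx_lt (prev s u).
  have := idx_next u; have := idx_prev u.
  by do 2!case: eqP; case: ifP; lia.
Qed.

Local Open Scope ring_scope.

Theorem theorem4p3 (R : realType) :
  exists c : R, 0 < c /\
    forall G : graph, is_cycle G ->
    forall d : G -> nat,
      (forall u : G, (0 < d u)%N) ->
      (forall u : G, (deg u %| d u)%N) ->
      c * (#|G| ^ 2)%:R <= (VC d)%:R.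
Proof.
(* For [n > 2] the floor of [n / 2] is at least [n / 3], with equality at [n = 3]; squaring gives
   the factor 9. *)
exists (9%:R^-1); split; first by rewrite Num.Theory.invr_gt0 Num.Theory.ltr0n.
move=> G Gcycle d d_gt0 deg_d.
have cardG_gt2 : (2 < #|G|)%N.
  have [s [s_gt2 s_uniq sG _]] := Gcycle.
  by rewrite -(eq_card sG) (card_uniqP s_uniq).
rewrite Num.Theory.ler_pdivrMl ?Num.Theory.ltr0n //.
rewrite -GRing.Theory.natrM Num.Theory.ler_nat.
apply: leq_trans (leq_mul (leqnn 9) (cycle_VC _ _ Gcycle d_gt0 deg_d)).
have : (#|G| <= 3 * #|G|./2)%N by lia.
nia.
Qed.
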